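(* Let $K$ be a field and let $n_1,n_2,i_1,i_2,k'$ be integers with $n_1\ge 5$, $n_2\ge 5$, $i_1>1$, $4<i_2<n_2$, $i_2\le n_1$, $i_2-i_1\ge 2$, $3\le k'\le n_2-2$, and $k'\ne n_1$, $k'\neq n_2$. Then the join-meet ideal $I_{L_2(n_1,n_2)[k',i_1,i_2]}\subset K[L_2(n_1,n_2)[k',i_1,i_2]]$ is a radical ideal.
   Context: For a finite lattice $L$ and a field $K$, $K[L]$ denotes the polynomial ring over $K$ whose variables $x_a$ are indexed by the elements $a\in L$. The join-meet ideal of $L$ is $I_L=(\{x_ax_b-x_{a\vee b}x_{a\wedge b}\mid a,b\in L\})\subset K[L]$. $L_2(n_1,n_2)[k',i_1,i_2]$ is the finite lattice on the $n_1+n_2+2$ distinct elements $\{s,a_1,\dots,a_{n_1},b_1,\dots,b_{n_2},t\}$ whose partial order is generated by the relations $s<a_1<\cdots<a_{n_1}<t$, $s<b_1<\cdots<b_{n_2}<t$, together with the additional relations $a_{i_1}<b_{k'}$ and $b_{k'}<a_{i_2}$. *)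

(* Defs.v *)
From HB Require Import structures.
From mathcomp Require Import all_boot all_order all_algebra zify.
From mathcomp Require Import mpoly.

Set Implicit Arguments.
Unset Strict Implicit.
Unset Printing Implicit Defensive.

Import Order.TTheory GRing.Theory.

Section JoinMeetIdeal.

Local Open Scope ring_scope.

Definition ideal_gen (R : comNzRingType) (G : R -> Prop) (p : R) : Prop :=
  exists2 s : seq (R * R),
    {in s, forall u, G u.2} & p = \sum_(u <- s) u.1 * u.2.

Definition ideal_radical (R : comNzRingType) (I : R -> Prop) (f : R) : Prop :=
  exists n, I (f ^+ n.+1).

Definition radical_ideal (R : comNzRingType) (I : R -> Prop) : Prop :=
  forall f, ideal_radical I f <-> I f.

(* K[L], with mpoly's variables numbered by the enumeration of L: x_a is the
   variable whose index is the rank of a. *)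
Definition lattice_poly (K : fieldType) d (L : finLatticeType d) :
  comNzRingType := {mpoly K[#|L|]}.

Definition lattice_var (K : fieldType) d (L : finLatticeType d) (a : L) :
  lattice_poly K L := 'X_(enum_rank a) : {mpoly K[#|L|]}.

Definition join_meet_gen (K : fieldType) d (L : finLatticeType d)
    (p : lattice_poly K L) : Prop :=
  exists a b : L,
    p = lattice_var K a * lattice_var K b
      - lattice_var K (Order.join a b) * lattice_var K (Order.meet a b).

Definition join_meet_ideal (K : fieldType) d (L : finLatticeType d) :
  lattice_poly K L -> Prop := ideal_gen (@join_meet_gen K d L).

End JoinMeetIdeal.

Arguments lattice_var K {d L}.
Arguments join_meet_gen K {d} L.
Arguments join_meet_ideal K {d} L.

Section Carrier.

Variables n1 n2 : nat.

(* Ordinals count from 0: L2a i stands for a_(i+1), L2b j for b_(j+1). *)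
Inductive L2_elt := L2s | L2a of 'I_n1 | L2b of 'I_n2 | L2t.

Definition L2_code (x : L2_elt) : option (option ('I_n1 + 'I_n2)) :=
  match x with
  | L2s => None
  | L2t => Some None
  | L2a i => Some (Some (inl i))
  | L2b j => Some (Some (inr j))
  end.

Definition L2_decode (c : option (option ('I_n1 + 'I_n2))) : L2_elt :=
  match c with
  | None => L2s
  | Some None => L2t
  | Some (Some (inl i)) => L2a i
  | Some (Some (inr j)) => L2b j
  end.

Lemma L2_codeK : cancel L2_code L2_decode. Proof. by case. Qed.

HB.instance Definition _ := Finite.copy L2_elt (can_type L2_codeK).

Lemma L2_decodeK : cancel L2_decode L2_code.
Proof. by case=> [[[]|]|]. Qed.

Lemma card_L2_elt : #|{: L2_elt}| = (n1 + n2 + 2)%N.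
Proof.
rewrite (bij_eq_card (Bijective L2_codeK L2_decodeK)).
by rewrite !card_option card_sum !card_ord addn2.
Qed.

End Carrier.

Arguments L2s {n1 n2}.
Arguments L2a {n1 n2}.
Arguments L2b {n1 n2}.
Arguments L2t {n1 n2}.

Section Order.

Variables n1 n2 k i1 i2 : nat.
Local Notation T := (L2_elt n1 n2).

(* The two chains, and a_i1 < b_k < a_i2. *)
Definition L2_gen : rel T := fun x y =>
  match x, y with
  | L2s, _ => x != y
  | _, L2t => x != y
  | L2a i, L2a i' => i < i'
  | L2b j, L2b j' => j < j'
  | L2a i, L2b j => (i.+1 == i1) && (j.+1 == k)
  | L2b j, L2a i => (j.+1 == k) && (i.+1 == i2)
  | _, _ => false
  end.

Definition L2_le : rel T := connect L2_gen.

(* For such indices L2_le is a lattice order; for others the extra relations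
   may mention missing elements or, if i2 <= i1, create a cycle. *)
Definition L2_wf : bool := [&& 0 < i1, i1 < i2, i2 <= n1, 0 < k & k <= n2].

Hypothesis wf : L2_wf.

Lemma L2_i1_subproof : i1.-1 < n1. Proof. by move: wf; rewrite /L2_wf; lia. Qed.
Lemma L2_i2_subproof : i2.-1 < n1. Proof. by move: wf; rewrite /L2_wf; lia. Qed.
Lemma L2_k_subproof : k.-1 < n2. Proof. by move: wf; rewrite /L2_wf; lia. Qed.

Let ai1 : T := L2a (Ordinal L2_i1_subproof).
Let ai2 : T := L2a (Ordinal L2_i2_subproof).
Let bk : T := L2b (Ordinal L2_k_subproof).

Definition L2_leb : rel T := fun x y =>
  match x, y with
  | L2s, _ => true
  | _, L2t => true
  | L2a i, L2a i' => i <= i'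
  | L2b j, L2b j' => j <= j'
  | L2a i, L2b j => (i < i1) && (k <= j.+1)
  | L2b j, L2a i => (j < k) && (i2 <= i.+1)
  | _, _ => false
  end.

Lemma L2_leb_refl : reflexive L2_leb.
Proof. by case=> //= ?; rewrite leqnn. Qed.

Lemma L2_leb_trans : transitive L2_leb.
Proof.
move: wf; rewrite /L2_wf.
by move=> w [|y|y|] [|x|x|] [|z|z|] //=; lia.
Qed.

Lemma L2_leb_anti : antisymmetric L2_leb.
Proof.
move: wf; rewrite /L2_wf => w [|x|x|] [|y|y|] //= h; try (exfalso; lia);
  by congr (_ _); apply: val_inj => /=; lia.
Qed.

Lemma L2_leE : L2_le =2 L2_leb.
Proof.
move: wf; rewrite /L2_wf => w x y; apply/idP/idP.
- case/connectP=> p; elim: p x => [|z p IHp] x /=.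
    by move=> _ ->; apply: L2_leb_refl.
  case/andP=> xz pz ylast.
  apply: (@L2_leb_trans z); last exact: IHp.
  by move: x z xz {pz ylast IHp} => [|x|x|] [|z|z|] //=; lia.
- have gen u v : (u == v) || L2_gen u v -> L2_le u v.
    by case/orP=> [/eqP -> | ?]; [apply: connect0 | apply: connect1].
  have leaa (i i' : 'I_n1) : i <= i' -> L2_le (L2a i) (L2a i').
    rewrite leq_eqVlt => /orP[/eqP/val_inj -> | ?]; first exact: connect0.
    exact: connect1.
  have lebb (j j' : 'I_n2) : j <= j' -> L2_le (L2b j) (L2b j').
    rewrite leq_eqVlt => /orP[/eqP/val_inj -> | ?]; first exact: connect0.
    exact: connect1.
  have le_ab : L2_le ai1 bk by apply: connect1 => /=; lia.
  have le_ba : L2_le bk ai2 by apply: connect1 => /=; lia.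
  case: x y => [|x|x|] [|y|y|] //= h; do ?[by apply: gen; rewrite orbC];
    do ?[exact: leaa | exact: lebb | exact: connect1].
  + apply: (connect_trans (leaa _ (Ordinal L2_i1_subproof) _)) => /=; first lia.
    apply: (connect_trans le_ab); apply: lebb => /=; lia.
  + apply: (connect_trans (lebb _ (Ordinal L2_k_subproof) _)) => /=; first lia.
    apply: (connect_trans le_ba); apply: leaa => /=; lia.
Qed.

Lemma L2_le_refl : reflexive L2_le.
Proof. exact: connect0. Qed.

Lemma L2_le_anti : antisymmetric L2_le.
Proof. by move=> x y; rewrite !L2_leE; apply: L2_leb_anti. Qed.

Lemma L2_le_trans : transitive L2_le.
Proof. exact: connect_trans. Qed.

Definition L2_join (x y : T) : T :=
  if L2_leb x y then y else if L2_leb y x then x else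
  match x, y with
  | L2a i, L2b j | L2b j, L2a i =>
      if i < i1 then bk else if j < k then ai2 else L2t
  | _, _ => L2t
  end.

Definition L2_meet (x y : T) : T :=
  if L2_leb x y then x else if L2_leb y x then y else
  match x, y with
  | L2a i, L2b j | L2b j, L2a i =>
      if i2 <= i.+1 then bk else if k <= j.+1 then ai1 else L2s
  | _, _ => L2s
  end.

Lemma L2_meetP x y z : L2_le x (L2_meet y z) = L2_le x y && L2_le x z.
Proof.
rewrite !L2_leE /L2_meet; move: wf; rewrite /L2_wf => w.
case: (boolP (L2_leb y z)) => [yz|nyz].
  case: (boolP (L2_leb x y)) => //= xy.
  by rewrite (L2_leb_trans xy yz).
case: (boolP (L2_leb z y)) => [zy|nzy].
  case: (boolP (L2_leb x z)) => xz; last by rewrite andbF.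
  by rewrite (L2_leb_trans xz zy).
move: x y z nyz nzy => [|x|x|] [|y|y|] [|z|z|] //=; repeat case: ifP => /=; lia.
Qed.

Lemma L2_joinP x y z : L2_le (L2_join x y) z = L2_le x z && L2_le y z.
Proof.
rewrite !L2_leE /L2_join; move: wf; rewrite /L2_wf => w.
case: (boolP (L2_leb x y)) => [xy|nxy].
  case: (boolP (L2_leb y z)) => yz; last by rewrite andbF.
  by rewrite (L2_leb_trans xy yz).
case: (boolP (L2_leb y x)) => [yx|nyx].
  case: (boolP (L2_leb x z)) => //= xz.
  by rewrite (L2_leb_trans yx xz).
move: x y z nxy nyx => [|x|x|] [|y|y|] [|z|z|] //=; repeat case: ifP => /=; lia.
Qed.

End Order.

Lemma L2_wf_intro n1 n2 k i1 i2 : 1 < i1 -> 2 <= i2 - i1 -> i2 <= n1 ->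
  3 <= k -> k <= n2 - 2 -> L2_wf n1 n2 k i1 i2.
Proof. by rewrite /L2_wf; lia. Qed.

Definition L2 n1 n2 k i1 i2 (wf : L2_wf n1 n2 k i1 i2) : Type := L2_elt n1 n2.

Fact L2_display : Order.disp_t. Proof. exact: Order.Disp tt tt. Qed.

Section Instances.

Variables (n1 n2 k i1 i2 : nat) (wf : L2_wf n1 n2 k i1 i2).

HB.instance Definition _ := Finite.copy (L2 wf) (L2_elt n1 n2).
HB.instance Definition _ := Order.Le_isPOrder.Build L2_display (L2 wf)
  (@L2_le_refl n1 n2 k i1 i2) (L2_le_anti wf) (@L2_le_trans n1 n2 k i1 i2).
HB.instance Definition _ := Order.POrder_MeetJoin_isLattice.Build
  L2_display (L2 wf) (L2_meetP wf) (L2_joinP wf).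

End Instances.

(* Main.v *)
Require Import Defs.
From HB Require Import structures.
From mathcomp Require Import all_boot all_order all_algebra.
From mathcomp Require Import mpoly zify ring.

(** The join-meet ideal is radical because, after a linear change of
    variables, its initial ideal is squarefree. In fact the new ideal is an
    intersection of kernels of toric maps into polynomial rings over [K],
    which are domains.

    Take one element from each part of the lattice that the relations
    distinguish: s = G00, a_i1 = G10, a_(i1+1) = G20, b_1 = G01, b_k = G11,
    a_i2 = G21, b_(k+1) = G12 and t = G22. The index of G_ij is a position in
    a 3 by 3 grid, the corner (0,2) being absent, and these eight elements
    form a distributive sublattice of that grid. Every other element is an
    extra copy of one of these eight corners: whether two elements are
    comparable, and what their join and meet are when they are not, depends
    only on their corners ([clash_free_comparable], [straighten_join_meet]).
    So the join-meet ideal is generated by the x_i x_j - x_w x_x where the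
    corners of i and j are incomparable and w, x are their meet and join in
    the grid; this is [fibre_gen].

    Two copies i, i' of the same corner satisfy (x_i - x_i') x_j = 0 modulo
    the ideal whenever their corner is incomparable with that of j. In the
    coordinates where x_i is replaced by its difference with the variable of
    its corner, the ideal becomes the Hibi ideal of the grid, given by five
    binomials, plus the monomials x_i x_j for incomparable corners of which at
    least one is represented by a difference variable ([reduced_gen]).

    For the reduced ideal, every polynomial is congruent to one whose
    monomials are standard, that is divisible by none of an explicit list of
    squarefree monomials ([reduce]). In the other direction, the Hibi ideal is
    the kernel of x_ij = a_i b_j. That map, preceded by killing the variables
    outside a set V of variables, still vanishes on the reduced ideal when V
    is a face: V contains both factors of one side of a binomial exactly when
    it contains both factors of the other side, and never both factors of a
    monomial generator ([toric_J]). The exponent map is injective on standard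
    monomials ([exponent_inj]), and the support of a standard monomial always
    lies in a face ([standard_sub_face], a finite check). Therefore a standard
    polynomial killed by all the toric maps is zero ([standard_eq0]). If p ^ e
    is in the ideal then every toric map kills p ^ e, hence p, hence the
    standard form of p, which is then zero: p is in the ideal. *)

Set Implicit Arguments.
Unset Strict Implicit.
Unset Printing Implicit Defensive.

Import Order.LTheory GRing.Theory.

(** * Generated ideals *)

Section GeneratedIdeals.

Local Open Scope ring_scope.

Variable R : comNzRingType.
Implicit Types (G : R -> Prop) (p q : R).

Lemma ideal_gen0 G : ideal_gen G 0.
Proof. by exists [::] => //; rewrite big_nil. Qed.

Lemma ideal_gen_incl G p : G p -> ideal_gen G p.
Proof.
move=> Gp; exists [:: (1, p)]; first by move=> u; rewrite inE => /eqP->.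
by rewrite big_seq1 mul1r.
Qed.

Lemma ideal_genD G p q : ideal_gen G p -> ideal_gen G q -> ideal_gen G (p + q).
Proof.
move=> [s Gs ->] [t Gt ->]; exists (s ++ t); last by rewrite big_cat.
by move=> u; rewrite mem_cat => /orP[/Gs|/Gt].
Qed.

Lemma ideal_genMl G p q : ideal_gen G q -> ideal_gen G (p * q).
Proof.
move=> [s Gs ->]; exists [seq (p * u.1, u.2) | u <- s].
  by move=> _ /mapP[u /Gs Gu ->].
by rewrite big_map mulr_sumr; apply: eq_bigr => u _; rewrite mulrA.
Qed.

Lemma ideal_genMr G p q : ideal_gen G q -> ideal_gen G (q * p).
Proof. by rewrite mulrC; apply: ideal_genMl. Qed.

Lemma ideal_genN G p : ideal_gen G p -> ideal_gen G (- p).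
Proof. by rewrite -mulN1r; apply: ideal_genMl. Qed.

Lemma ideal_genB G p q : ideal_gen G p -> ideal_gen G q -> ideal_gen G (p - q).
Proof. by move=> Gp Gq; apply: ideal_genD => //; apply: ideal_genN. Qed.

End GeneratedIdeals.

Lemma ideal_gen_morph (R S : comNzRingType) (G : R -> Prop) (H : S -> Prop)
    (f : {rmorphism R -> S}) :
    (forall g, G g -> ideal_gen H (f g)) ->
  forall p, ideal_gen G p -> ideal_gen H (f p).
Proof.
move=> GH p [s Gs ->]; rewrite rmorph_sum big_seq.
apply: big_ind => [||u /Gs Gu]; [exact: ideal_gen0 | exact: ideal_genD |].
by rewrite rmorphM; apply/ideal_genMl/GH.
Qed.

(** * The grid lattice and its straightening relations *)

Inductive corner := G00 | G10 | G20 | G01 | G11 | G21 | G12 | G22.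

Definition corners := [:: G00; G10; G20; G01; G11; G21; G12; G22].

Definition corner_code (u : corner) : nat :=
  match u with
  | G00 => 0 | G10 => 1 | G20 => 2 | G01 => 3
  | G11 => 4 | G21 => 5 | G12 => 6 | G22 => 7
  end.

Definition corner_decode (c : nat) : corner :=
  nth G00 corners c.

Lemma corner_codeK : cancel corner_code corner_decode. Proof. by case. Qed.

HB.instance Definition _ := Equality.copy corner (can_type corner_codeK).

Lemma mem_corners u : u \in corners. Proof. by case: u. Qed.

(** The incomparable pairs of the grid, each listed once, with its meet and
    its join. These are the five 2 by 2 minors of the matrix of the x_ij that
    avoid the absent corner (0,2). *)
Definition straighten (u v : corner) : option (corner * corner) :=
  match u, v with
  | G10, G01 => Some (G00, G11)
  | G20, G01 => Some (G00, G21)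
  | G20, G11 => Some (G10, G21)
  | G20, G12 => Some (G10, G22)
  | G21, G12 => Some (G11, G22)
  | _, _ => None
  end.

(** The variable of G01, G11, G21 doubles as the parameter a_0, a_1, a_2 of
    x_ij = a_i b_j, and that of G00, G22 as b_0, b_2; the parameter b_1 is set
    to 1, which leaves the kernel unchanged because the minors are homogeneous.
    The list collects the corners whose monomial involves the given
    parameter. *)
Definition torus (u : corner) : seq corner :=
  match u with
  | G01 => [:: G00; G01]
  | G11 => [:: G10; G11; G12]
  | G21 => [:: G20; G21; G22]
  | G00 => [:: G00; G10; G20]
  | G22 => [:: G12; G22]
  | _ => [::]
  end.

(** 16 minus the square of the rank in the grid. The ranks of meet and join
    have the same sum as those of the two elements but are further apart, so
    straightening strictly lowers the total weight. *)
Definition weight (u : corner) : nat :=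
  match u with
  | G00 => 16 | G10 | G01 => 15 | G20 | G11 => 12 | G21 | G12 => 7 | G22 => 0
  end.

(** * Faces *)

(** The kind of a variable is its corner, together with [true] when it
    represents that corner and [false] when it is a difference variable. The
    ideal only sees kinds, which turns statements about supports into finite
    checks. *)
Definition kind := (corner * bool)%type.

(** Difference variables at G11 are left out: a second variable at this corner
    would bring monomials of degree four into the initial ideal. *)
Definition kinds : seq kind :=
  [seq (u, true) | u <- corners] ++ [seq (u, false) | u <- corners & u != G11].

Definition clash (k l : kind) := straighten k.1 l.1 != None.

Definition edge (k l : kind) := clash k l && ~~ (k.2 && l.2).

Definition adjacent (k l : kind) := edge k l || edge l k.

(** If x_k x_u or x_k x_v is in the reduced ideal, then so are x_k x_u x_v and
    x_k x_w x_x, which are congruent to each other. These cubic monomials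
    complete the quadratic leading terms to the generators of the initial
    ideal. *)
Definition blocked (S : seq kind) (k : kind) (u v : corner) :=
  if straighten u v is Some (w, x) then
    [&& ~~ k.2, adjacent k (u, true) || adjacent k (v, true),
        (w, true) \in S & (x, true) \in S]
  else false.

Definition clash_free (S : seq kind) :=
  all (fun k => all (fun l => ~~ clash k l) S) S.

Definition unblocked (S : seq kind) :=
  all (fun k => all (fun u => all (fun v => ~~ blocked S k u v)
    corners) corners) S.

Definition standard (S : seq kind) := clash_free S && unblocked S.

Definition face (V : seq kind) :=
  all (fun k => all (fun l => ~~ edge k l) V) V &&
  all (fun u => all (fun v =>
    if straighten u v is Some (w, x) then
      (((u, true) \in V) && ((v, true) \in V)) ==
      (((w, true) \in V) && ((x, true) \in V))
    else true) corners) corners.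

(** One round of adding to V what the binomial part of the definition of a face
    requires. *)
Definition complete (V : seq kind) : seq kind :=
  V ++ flatten [seq
    if straighten u v is Some (w, x) then
      if ((u, true) \in V) && ((v, true) \in V) ||
         ((w, true) \in V) && ((x, true) \in V)
      then [:: (u, true); (v, true); (w, true); (x, true)] else [::]
    else [::] | u <- corners, v <- corners].

Definition subsets (T : Type) (s : seq T) : seq (seq T) :=
  foldr (fun x ss => ss ++ map (cons x) ss) [:: [::]] s.

Lemma filter_subsets (T : eqType) (P : pred T) s : filter P s \in subsets s.
Proof.
elim: s => //= x s IH; rewrite mem_cat.
by case: (P x); rewrite ?map_f ?orbT ?IH.
Qed.

(** Two rounds always suffice.  The sets are filtered in two stages to keep the
    computation short, as evaluation is eager in conjunctions. *)
Lemma complete_face :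
  all (fun S => face (complete (complete S)))
    [seq S <- [seq S <- subsets kinds | clash_free S] | unblocked S].
Proof. by vm_compute. Qed.

Lemma standard_sub_face (P : pred kind) (S := filter P kinds) :
  standard S -> exists2 V, face V & {subset S <= V}.
Proof.
move=> /andP[freeS unblS]; exists (complete (complete S)).
  apply: (allP complete_face); rewrite !mem_filter unblS freeS.
  exact: filter_subsets.
by move=> k kS; do 2!rewrite mem_cat; rewrite kS.
Qed.

(** * The fibre ideal in difference coordinates *)

Section FibreIdeal.

Local Open Scope ring_scope.

Variables (K : fieldType) (n : nat).
Variables (cls : 'I_n -> corner) (rep : corner -> 'I_n).
Hypothesis repK : cancel rep cls.
Hypothesis cls_G11 : forall i, cls i = G11 -> i = rep G11.

Local Notation P := {mpoly K[n]}.

Definition is_rep (i : 'I_n) := i == rep (cls i).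

Definition fibre_gen (p : P) : Prop :=
  exists i j w x, straighten (cls i) (cls j) = Some (w, x) /\
    p = 'X_i * 'X_j - 'X_(rep w) * 'X_(rep x).

Definition reduced_gen (p : P) : Prop :=
  exists i j w x, straighten (cls i) (cls j) = Some (w, x) /\
    p = 'X_i * 'X_j
      - (if is_rep i && is_rep j then 'X_(rep w) * 'X_(rep x) else 0).

Local Notation I := (ideal_gen fibre_gen).
Local Notation J := (ideal_gen reduced_gen).

Lemma is_rep_rep u : is_rep (rep u).
Proof. by rewrite /is_rep repK. Qed.

Lemma is_repP i : reflect (exists u, i = rep u) (is_rep i).
Proof.
by apply: (iffP eqP) => [->|[u ->]]; [exists (cls i) | rewrite repK].
Qed.

Lemma rep_eq u v : (rep u == rep v) = (u == v).
Proof. exact: (inj_eq (can_inj repK)). Qed.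

(** * Reduction to standard monomials *)

Implicit Types m : 'X_{1..n}.

Definition kind_of (i : 'I_n) : kind := (cls i, is_rep i).

Lemma kind_of_rep u : kind_of (rep u) = (u, true).
Proof. by rewrite /kind_of repK is_rep_rep. Qed.

Lemma kind_of_mem i : kind_of i \in kinds.
Proof.
rewrite /kind_of; case: (boolP (is_rep i)) => ri; first by case: (cls i).
have: cls i != G11 by apply: contraNneq ri => /cls_G11 ->; apply: is_rep_rep.
by case: (cls i).
Qed.

Definition kind_support m : seq kind :=
  [seq k <- kinds | [exists i, (kind_of i == k) && (m i != 0)%N]].

Lemma kind_supportP k m :
  reflect (exists2 i, kind_of i = k & m i != 0%N) (k \in kind_support m).
Proof.
rewrite mem_filter; apply: (iffP andP) => [[/existsP[i /andP[/eqP ki mi]] _]|].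
  by exists i.
move=> [i <- mi]; split; last exact: kind_of_mem.
by apply/existsP; exists i; rewrite eqxx.
Qed.

Definition standard_mnm m := standard (kind_support m).

(** The quantity that decreases in the rewriting by the five binomials. *)
Definition potential m := (\sum_(u <- corners) weight u * m (rep u))%N.

Lemma J_edge i j w x : straighten (cls i) (cls j) = Some (w, x) ->
  ~~ (is_rep i && is_rep j) -> J ('X_i * 'X_j).
Proof.
move=> sij nrep; apply: ideal_gen_incl; exists i, j, w, x; split=> //.
by rewrite (negbTE nrep) subr0.
Qed.

Lemma J_square u v w x : straighten u v = Some (w, x) ->
  J ('X_(rep u) * 'X_(rep v) - 'X_(rep w) * 'X_(rep x)).
Proof.
move=> suv; apply: ideal_gen_incl; exists (rep u), (rep v), w, x.
by rewrite !repK !is_rep_rep.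
Qed.

Lemma clash_neq i j : clash (kind_of i) (kind_of j) -> i != j.
Proof.
by apply: contraTneq => ->; rewrite /clash /=; case: (cls j).
Qed.

Lemma mnm_split2 m i j : i != j -> m i != 0%N -> m j != 0%N ->
  m = (m - (U_(i) + U_(j)) + (U_(i) + U_(j)))%MM.
Proof.
move=> ij mi mj; rewrite submK //; apply/mnm_lepP => l; rewrite mnmDE !mnm1E.
case: (i =P l) => [<-|_]; first by rewrite eq_sym (negbTE ij) /=; lia.
by case: (j =P l) => [<-|_] /=; lia.
Qed.

Lemma J_adjacent i u v : ~~ is_rep i ->
    adjacent (kind_of i) (u, true) || adjacent (kind_of i) (v, true) ->
  J ('X_i * ('X_(rep u) * 'X_(rep v))).
Proof.
move=> nri.
have adjJ z : adjacent (kind_of i) (z, true) -> J ('X_i * 'X_(rep z)).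
  rewrite /adjacent /edge /clash /= andbT nri /=.
  case/orP.
    case E: (straighten (cls i) z) => [[a b]|] //= _.
    by apply: (@J_edge _ _ a b); rewrite ?repK ?(negbTE nri).
  case E: (straighten z (cls i)) => [[a b]|] //= _; rewrite mulrC.
  by apply: (@J_edge _ _ a b); rewrite ?repK ?(negbTE nri) ?andbF.
case/orP=> /adjJ; first by rewrite mulrA; apply: ideal_genMr.
by rewrite mulrCA; apply: ideal_genMl.
Qed.

(** A monomial that fails to be standard either contains an incomparable pair
    of corners, and is straightened, or contains a monomial of the ideal. *)
Lemma reduce_mnm m :
  J 'X_[m] \/ exists2 m', standard_mnm m' & J ('X_[m] - 'X_[m']).
Proof.
have [b] := ubnP (potential m); elim: b m => // b IH m lt_mb.
have [|] := boolP (standard_mnm m).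
  by right; exists m; rewrite // subrr; apply: ideal_gen0.
rewrite /standard_mnm /standard negb_and => /orP[] /allPn[k kS /allPn].
  move=> [l lS]; rewrite negbK.
  case/kind_supportP: kS => i <- mi; case/kind_supportP: lS => j <- mj cij.
  have ij := clash_neq cij; have defm := mnm_split2 ij mi mj.
  move: cij; rewrite /clash /=.
  case sij: (straighten (cls i) (cls j)) => [[w x]|] // _.
  set m0 := (m - _)%MM in defm; clearbody m0.
  have [ri|nrep] := boolP (is_rep i && is_rep j); last first.
    left; rewrite defm mpolyXD mpolyXD; apply: ideal_genMl.
    exact: J_edge sij nrep.
  have /andP[/is_repP[u iu] /is_repP[v jv]] := ri.
  subst i j; rewrite !repK in sij; clear ri.
  (* Both variables represent their corner: replace them by meet and join. *)
  have red : J ('X_[m] - 'X_[m0 + (U_(rep w) + U_(rep x))]).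
    rewrite defm !mpolyXD -mulrBr; apply: ideal_genMl.
    exact: J_square.
  have /IH : (potential (m0 + (U_(rep w) + U_(rep x))) < b)%N.
    rewrite ltnS in lt_mb; apply: leq_trans lt_mb.
    rewrite [X in (_ < potential X)%N]defm.
    rewrite /potential /corners !big_cons !big_nil !mnmDE !mnm1E !rep_eq.
    by clear -sij; case: u v sij => [] [] //= [<- <-] /=; lia.
  case=> [Jm'|[m' st' Jm']]; [left|right; exists m' => //].
    rewrite -[X in J X](subrK 'X_[m0 + (U_(rep w) + U_(rep x))]).
    exact: ideal_genD.
  by have := ideal_genD red Jm'; rewrite addrA subrK.
move=> [u _ /allPn[v _]]; rewrite negbK /blocked.
case suv: (straighten u v) => [[w x]|] //= /and4P[nk adj wS xS]; left.
case/kind_supportP: kS => i ki mi.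
case/kind_supportP: wS => w' kw mw; case/kind_supportP: xS => x' kx mx.
have wE : w' = rep w by case: kw => <- /eqP.
have xE : x' = rep x by case: kx => <- /eqP.
subst w' x' k.
have wx : rep w != rep x.
  by rewrite rep_eq; case: u v suv {adj} => [] [] //= [<- <-].
have iw z : i != rep z by apply: contraNneq nk => ->; apply: is_rep_rep.
have defm : m = (m - (U_(i) + (U_(rep w) + U_(rep x)))
                 + (U_(i) + (U_(rep w) + U_(rep x))))%MM.
  rewrite submK //; apply/mnm_lepP => l; rewrite !mnmDE !mnm1E.
  have := iw w; have := iw x; move: wx mi mw mx.
  case: (i =P l) => [<-|_].
    by rewrite ![_ == i]eq_sym => _ mi _ _ /negbTE-> /negbTE->; lia.
  case: (rep w =P l) => [<-|_]; first by rewrite eq_sym => /negbTE->; lia.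
  by case: (rep x =P l) => [<-|_] /=; lia.
rewrite defm !mpolyXD; apply: ideal_genMl.
have -> : 'X_i * ('X_(rep w) * 'X_(rep x)) =
    'X_i * ('X_(rep u) * 'X_(rep v))
    - 'X_i * ('X_(rep u) * 'X_(rep v) - 'X_(rep w) * 'X_(rep x)) :> P.
  by rewrite mulrBr opprB addrCA subrr addr0.
apply: ideal_genB; last exact/ideal_genMl/J_square.
exact: J_adjacent nk adj.
Qed.

Lemma reduce p : exists2 q, {in msupp q, forall m, standard_mnm m} & J (p - q).
Proof.
rewrite [p]mpolyE.
apply: (big_ind (fun p => exists2 q, {in msupp q, forall m, standard_mnm m}
  & J (p - q))) => [|p1 p2 [q1 st1 J1] [q2 st2 J2]|m _].
- by exists 0; [move=> m; rewrite msupp0 | rewrite subrr; apply: ideal_gen0].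
- exists (q1 + q2); last by rewrite opprD addrACA; apply: ideal_genD.
  by move=> m /msuppD_le; rewrite mem_cat => /orP[/st1|/st2].
have [Jm|[m' st' Jm]] := reduce_mnm m.
  exists 0; first by move=> ?; rewrite msupp0.
  by rewrite subr0 -mul_mpolyC; apply: ideal_genMl.
exists (p@_m *: 'X_[m']).
  by move=> ? /msuppZ_le; rewrite msuppX inE => /eqP->.
by rewrite -scalerBr -mul_mpolyC; apply: ideal_genMl.
Qed.

(** * Toric maps *)

(** The exponent of the image of a monomial under x_ij = a_i b_j, difference
    variables being kept as they are. *)
Definition exponent m : 'X_{1..n} :=
  [multinom if is_rep j then \sum_(u <- torus (cls j)) m (rep u) else m j
  | j < n]%N.

Lemma exponentD m1 m2 : exponent (m1 + m2) = (exponent m1 + exponent m2)%MM.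
Proof.
apply/mnmP => j; rewrite mnmDE !mnmE; case: ifP => // _.
by rewrite -big_split; apply: eq_bigr => u _; rewrite mnmDE.
Qed.

Lemma exponent0 : exponent 0 = 0%MM.
Proof.
apply/mnmP => j; rewrite !mnmE; case: ifP => // _.
by rewrite big1 // => u; rewrite mnmE.
Qed.

Lemma exponentMn m e : exponent (m *+ e) = (exponent m *+ e)%MM.
Proof.
elim: e => [|e IH]; first by rewrite !mulm0n exponent0.
by rewrite !mulmS exponentD IH.
Qed.

Lemma exponent_sum (m_ : 'I_n -> 'X_{1..n}) :
  exponent (\sum_i m_ i)%MM = (\sum_i exponent (m_ i))%MM.
Proof. exact: (big_morph exponent exponentD exponent0). Qed.

Lemma exponent_square u v w x : straighten u v = Some (w, x) ->
  exponent (U_(rep u) + U_(rep v)) = exponent (U_(rep w) + U_(rep x)).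
Proof.
move=> suv; apply/mnmP => j; rewrite !mnmE; case: ifPn => [|nrj].
  move=> /is_repP[z ->]; rewrite repK; case: u v suv => [] [] //= [<- <-];
    by case: z; rewrite /= ?big_cons ?big_nil ?mnmDE ?mnm1E ?rep_eq.
have repj z : (rep z == j) = false.
  by apply: contraNF nrj => /eqP <-; apply: is_rep_rep.
by rewrite !repj.
Qed.

(** The corners in the support of a standard monomial form a chain, and the
    degrees in the a_i and in the b_j determine the multiplicities along a
    chain of the grid: both lists of indices are matched in increasing order.
    *)
Lemma exponent_inj m1 m2 : standard_mnm m1 -> standard_mnm m2 ->
  exponent m1 = exponent m2 -> m1 = m2.
Proof.
have std0 m u v : standard_mnm m -> straighten u v != None ->
    (m (rep u) = 0 \/ m (rep v) = 0)%N.
  move=> /andP[/allP freem _] suv.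
  have [|nu] := eqVneq (m (rep u)) 0%N; first by left.
  have [|nv] := eqVneq (m (rep v)) 0%N; first by right.
  have mS z : m (rep z) != 0%N -> (z, true) \in kind_support m.
    by move=> mz; apply/kind_supportP; exists (rep z); rewrite ?kind_of_rep.
  have /allP/(_ _ (mS _ nv)) := freem _ (mS _ nu).
  by rewrite /clash /= suv.
move=> st1 st2 eqm.
have eqr u : (\sum_(v <- torus u) m1 (rep v) = \sum_(v <- torus u) m2 (rep v))%N.
  by have /mnmP/(_ (rep u)) := eqm; rewrite !mnmE is_rep_rep repK.
have eqrep u : m1 (rep u) = m2 (rep u).
  move: (eqr G00) (eqr G01) (eqr G11) (eqr G21) (eqr G22).
  rewrite /= !big_cons !big_nil.
  have squares m : standard_mnm m ->
    [/\ m (rep G10) = 0 \/ m (rep G01) = 0, m (rep G20) = 0 \/ m (rep G01) = 0,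
        m (rep G20) = 0 \/ m (rep G11) = 0, m (rep G20) = 0 \/ m (rep G12) = 0
      & m (rep G21) = 0 \/ m (rep G12) = 0]%N.
    by move=> st; split; apply: std0.
  have [a1 a2 a3 a4 a5] := squares _ st1; have [b1 b2 b3 b4 b5] := squares _ st2.
  by clear -a1 a2 a3 a4 a5 b1 b2 b3 b4 b5; case: u; lia.
apply/mnmP => j; have [/is_repP[u ->] //|nrj] := boolP (is_rep j).
by have /mnmP/(_ j) := eqm; rewrite !mnmE (negbTE nrj).
Qed.

Definition toric (V : seq kind) (p : P) : P :=
  p \mPo [tuple if kind_of i \in V then 'X_[exponent U_(i)] else 0 | i < n].

HB.instance Definition _ V := GRing.RMorphism.copy (toric V)
  (comp_mpoly [tuple if kind_of i \in V then 'X_[exponent U_(i)] else 0 | i < n]).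

Lemma toricX V m : toric V 'X_[m] =
  if [forall i, (m i != 0)%N ==> (kind_of i \in V)] then 'X_[exponent m] else 0.
Proof.
rewrite /toric comp_mpolyX; case: ifPn => [/forallP mV|].
  rewrite [in RHS](multinomUE_id m) exponent_sum -mprodXE; apply: eq_bigr => i _.
  rewrite tnth_mktuple exponentMn -mpolyXn.
  by have := mV i; case: (m i) => [|e] /=; [rewrite !expr0 | move=> ->].
rewrite negb_forall => /existsP[i]; rewrite negb_imply => /andP[mi iV].
by rewrite (bigD1 i) //= tnth_mktuple (negbTE iV) expr0n (negbTE mi) mul0r.
Qed.

Lemma toricXU V i : toric V 'X_i = if kind_of i \in V then 'X_[exponent U_(i)] else 0.
Proof. by rewrite /toric comp_mpolyXU -tnth_nth tnth_mktuple. Qed.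

Lemma toric_J V : face V -> forall p, J p -> toric V p = 0.
Proof.
move=> /andP[/allP noedge /allP balanced] p [s Js ->].
rewrite rmorph_sum big_seq big1 // => g /Js[i [j [w [x [sij gE]]]]].
rewrite rmorphM /=; suff -> : toric V g.2 = 0 by rewrite mulr0.
have cij : clash (kind_of i) (kind_of j) by rewrite /clash /= sij.
rewrite gE rmorphB rmorphM /=; case: ifPn => [|nrep]; last first.
  rewrite rmorph0 subr0 !toricXU.
  case: ifPn => iV; last by rewrite mul0r.
  case: ifPn => jV; last by rewrite mulr0.
  by have /allP/(_ _ jV) := noedge _ iV; rewrite /edge cij nrep.
case/andP=> /is_repP[u iu] /is_repP[v jv]; subst i j; rewrite !repK in sij.
rewrite rmorphM /= !toricXU !kind_of_rep.
have /allP/(_ v (mem_corners v)) := balanced u (mem_corners u).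
rewrite sij => /eqP; have := exponent_square sij.
rewrite !exponentD; do 4!case: (_ \in V) => //=; rewrite ?mul0r ?mulr0 ?subrr //.
by move=> + _; rewrite -!mpolyXD => ->; rewrite subrr.
Qed.

(** Were m0 in the support of p, the toric map of a face containing m0 would
    have the coefficient of m0 as its own coefficient at the exponent of m0,
    since no other monomial of p has this exponent. *)
Lemma standard_eq0 p : {in msupp p, forall m, standard_mnm m} ->
  (forall V, face V -> toric V p = 0) -> p = 0.
Proof.
move=> stp tp0; apply/eqP; rewrite -msupp_eq0; apply/eqP.
case E: (msupp p) => [//|m0 ms]; exfalso.
have m0p : m0 \in msupp p by rewrite E mem_head.
have [V faceV sV] := standard_sub_face (stp _ m0p).
have m0V : [forall i, (m0 i != 0)%N ==> (kind_of i \in V)].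
  apply/forallP => i; apply/implyP => m0i; apply: sV.
  by apply/kind_supportP; exists i.
have := congr1 (mcoeff (exponent m0)) (tp0 V faceV); rewrite mcoeff0.
rewrite [p in toric V p]mpolyE rmorph_sum raddf_sum /=.
rewrite (bigD1_seq m0) ?msupp_uniq //= big_seq_cond big1 => [|m].
  rewrite addr0 /toric linearZ /= -/(toric V _) toricX m0V.
  rewrite mcoeffZ mcoeffX eqxx mulr1.
  by apply/eqP; rewrite mcoeff_eq0 m0p.
case/andP=> mp mm0; rewrite /toric linearZ /= -/(toric V _) toricX mcoeffZ.
case: ifP => _; rewrite ?mcoeff0 ?mulr0 // mcoeffX.
case: eqP => [eqm|_]; last by rewrite mulr0.
by rewrite (exponent_inj (stp _ mp) (stp _ m0p) eqm) eqxx in mm0.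
Qed.

(** The target of the toric maps is a domain, so they kill p as soon as they
    kill a power of p. *)
Lemma reduced_radical p e : J (p ^+ e) -> J p.
Proof.
move=> Jpe; have [q stq Jpq] := reduce p.
suff q0 : q = 0 by rewrite q0 subr0 in Jpq.
apply: standard_eq0 stq _ => V faceV.
have tp : toric V p = 0.
  have /eqP := toric_J faceV Jpe; rewrite rmorphXn /= expf_eq0.
  by case/andP=> _ /eqP.
have /eqP := toric_J faceV Jpq.
by rewrite rmorphB /= tp sub0r oppr_eq0 => /eqP.
Qed.

(** * Change of coordinates *)

Definition shift (i : 'I_n) : P := if is_rep i then 0 else 'X_(rep (cls i)).

Definition to_reduced (p : P) : P := p \mPo [tuple 'X_i + shift i | i < n].
Definition of_reduced (p : P) : P := p \mPo [tuple 'X_i - shift i | i < n].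

HB.instance Definition _ := GRing.RMorphism.copy to_reduced
  (comp_mpoly [tuple 'X_i + shift i | i < n]).
HB.instance Definition _ := GRing.RMorphism.copy of_reduced
  (comp_mpoly [tuple 'X_i - shift i | i < n]).

Lemma to_reducedX i : to_reduced 'X_i = 'X_i + shift i.
Proof. by rewrite /to_reduced comp_mpolyXU -tnth_nth tnth_mktuple. Qed.

Lemma of_reducedX i : of_reduced 'X_i = 'X_i - shift i.
Proof. by rewrite /of_reduced comp_mpolyXU -tnth_nth tnth_mktuple. Qed.

Lemma shift_rep u : shift (rep u) = 0.
Proof. by rewrite /shift is_rep_rep. Qed.

(** This one composite is enough to pull radicality back along the change of
    coordinates. *)
Lemma of_to_reduced p : of_reduced (to_reduced p) = p.
Proof.
rewrite /to_reduced comp_mpolyEX rmorph_sum [RHS]mpolyE /=; apply: eq_bigr => m _.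
rewrite /of_reduced linearZ /= -/(of_reduced _); congr (_ *: _).
rewrite comp_mpolyX rmorph_prod mpolyXE_id; apply: eq_bigr => i _.
rewrite rmorphXn tnth_mktuple rmorphD /= of_reducedX; congr (_ ^+ _).
suff -> : of_reduced (shift i) = shift i by rewrite subrK.
rewrite {1}/shift; case: ifPn => ri; first by rewrite rmorph0 /shift ri.
by rewrite of_reducedX shift_rep subr0 /shift (negbTE ri).
Qed.

Lemma to_reduced_gen p : fibre_gen p -> J (to_reduced p).
Proof.
case=> i [j [w [x [sij ->]]]].
have Ji i' j' : cls i' = cls i -> cls j' = cls j ->
    J ('X_i' * 'X_j' - (if is_rep i' && is_rep j'
                        then 'X_(rep w) * 'X_(rep x) else 0)).
  by move=> ci cj; apply: ideal_gen_incl; exists i', j', w, x; rewrite ci cj.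
rewrite rmorphB !rmorphM /= !to_reducedX !shift_rep !addr0 /shift.
have Jij := Ji i j erefl erefl.
have Jiv := Ji i (rep (cls j)) erefl (repK _).
have Juj := Ji (rep (cls i)) j (repK _) erefl.
have Juv := Ji (rep (cls i)) (rep (cls j)) (repK _) (repK _).
move: Jij Jiv Juj Juv; rewrite !is_rep_rep andbT /=.
case: (is_rep i); case: (is_rep j); rewrite /= ?addr0 ?subr0 // => Jij Jiv Juj Juv.
- by rewrite mulrDr -addrA; apply: ideal_genD.
- by rewrite mulrDl -addrA; apply: ideal_genD.
by rewrite mulrDl !mulrDr -!addrA; do 3!apply: ideal_genD => //.
Qed.

(** A product with a difference as a factor expands into an alternating sum of
    products x_i' x_j' with the same two corners, which are all congruent. *)
Lemma of_reduced_gen p : reduced_gen p -> I (of_reduced p).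
Proof.
case=> i [j [w [x [sij ->]]]].
have Ii i' j' : cls i' = cls i -> cls j' = cls j ->
    I ('X_i' * 'X_j' - 'X_(rep w) * 'X_(rep x)).
  by move=> ci cj; apply: ideal_gen_incl; exists i', j', w, x; rewrite ci cj.
have Iij := Ii i j erefl erefl.
have Iiv := Ii i (rep (cls j)) erefl (repK _).
have Iuj := Ii (rep (cls i)) j (repK _) erefl.
have Iuv := Ii (rep (cls i)) (rep (cls j)) (repK _) (repK _).
rewrite rmorphB rmorphM /= !of_reducedX /shift.
case: (is_rep i); case: (is_rep j); rewrite /= ?rmorph0 ?subr0.
- by rewrite rmorphM /= !of_reducedX !shift_rep !subr0.
- by have := ideal_genB Iij Iiv; congr ideal_gen; ring.
- by have := ideal_genB Iij Iuj; congr ideal_gen; ring.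
by have := ideal_genB (ideal_genB Iij Iiv) (ideal_genB Iuj Iuv); congr ideal_gen; ring.
Qed.

Theorem fibre_radical : radical_ideal I.
Proof.
move=> p; split=> [[e Ipe]|Ip]; last by exists 0%N.
rewrite -[p]of_to_reduced.
apply: (ideal_gen_morph of_reduced_gen); apply: (@reduced_radical _ e.+1).
rewrite -rmorphXn; exact: (ideal_gen_morph to_reduced_gen).
Qed.

End FibreIdeal.

(** * The lattice L2 as an inflated grid *)

Section InflatedGrid.

Local Open Scope ring_scope.

Variables (K : fieldType) (n1 n2 k i1 i2 : nat) (wf : L2_wf n1 n2 k i1 i2).
Hypotheses (i1_i2 : (i1.+1 < i2)%N) (k_gt1 : (1 < k)%N) (k_n2 : (k < n2)%N).

Local Notation L := (L2 wf).

(** The a-chain is cut at a_i1 and a_i2, the b-chain at b_k: inside each part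
    all elements have the same incomparable elements, joins and meets. *)
Definition corner_of (x : L2_elt n1 n2) : corner :=
  match x with
  | L2s => G00
  | L2a i => if (i < i1)%N then G10 else if (i.+1 < i2)%N then G20 else G21
  | L2b j => if (j.+1 < k)%N then G01 else if (j.+1 == k)%N then G11 else G12
  | L2t => G22
  end.

Fact a_mid_subproof : (i1 < n1)%N.
Proof. by move: wf; rewrite /L2_wf; lia. Qed.

Fact b_first_subproof : (0 < n2)%N. Proof. exact: leq_ltn_trans k_n2. Qed.

Definition grid_point (u : corner) : L :=
  match u with
  | G00 => L2s
  | G10 => L2a (Ordinal (L2_i1_subproof wf))
  | G20 => L2a (Ordinal a_mid_subproof)
  | G01 => L2b (Ordinal b_first_subproof)
  | G11 => L2b (Ordinal (L2_k_subproof wf))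
  | G21 => L2a (Ordinal (L2_i2_subproof wf))
  | G12 => L2b (Ordinal k_n2)
  | G22 => L2t
  end.

Lemma grid_pointK : cancel grid_point corner_of.
Proof.
move: wf; rewrite /L2_wf => ?.
by case=> //=; repeat case: ifP => //=; lia.
Qed.

Lemma corner_of_G11 x : corner_of x = G11 -> x = grid_point G11.
Proof.
case: x => //= i; first by case: ifP => // _; case: ifP.
case: ifP => // _; case: eqP => // ik _; congr L2b; apply: val_inj => /=; lia.
Qed.

Lemma straighten_join_meet (x y : L) w z :
    straighten (corner_of x) (corner_of y) = Some (w, z) ->
  Order.join x y = grid_point z /\ Order.meet x y = grid_point w.
Proof.
move: (wf); rewrite /L2_wf => ?.
rewrite /Order.join /Order.meet /= /L2_join /L2_meet.
case: x => [|x|x|]; case: y => [|y|y|] //=;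
  repeat case: ifP => //=; intros;
  match goal with H : Some _ = Some _ |- _ => case: H => <- <- end;
  split => //=; try (exfalso; lia); congr (_ _); apply: val_inj => /=; lia.
Qed.

Lemma clash_free_comparable (x y : L) :
    straighten (corner_of x) (corner_of y) = None ->
    straighten (corner_of y) (corner_of x) = None ->
  (x <= y)%O || (y <= x)%O.
Proof.
rewrite /Order.le /= !(L2_leE wf).
move: (wf); rewrite /L2_wf => ?.
by case: x => [|x|x|]; case: y => [|y|y|] //=; repeat case: ifP => //=; lia.
Qed.

Definition var_corner (r : 'I_#|{: L}|) : corner := corner_of (enum_val r).
Definition corner_var (u : corner) : 'I_#|{: L}| := enum_rank (grid_point u).

Lemma corner_varK : cancel corner_var var_corner.
Proof. by move=> u; rewrite /var_corner enum_rankK grid_pointK. Qed.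

Lemma var_corner_G11 r : var_corner r = G11 -> r = corner_var G11.
Proof.
by move=> /corner_of_G11 rE; rewrite /corner_var -rE enum_valK.
Qed.

Local Notation fibre_ideal :=
  (ideal_gen (@fibre_gen K _ var_corner corner_var)).

Lemma join_meet_gen_fibre p : join_meet_gen K L p -> fibre_ideal p.
Proof.
have straight (a b : L) w z :
    straighten (corner_of a) (corner_of b) = Some (w, z) ->
  fibre_ideal (lattice_var K a * lattice_var K b
    - lattice_var K (Order.join a b) * lattice_var K (Order.meet a b)).
  move=> sab; have [-> ->] := straighten_join_meet sab.
  apply: ideal_gen_incl; exists (enum_rank a), (enum_rank b), w, z.
  rewrite /var_corner !enum_rankK; split=> //.
  by congr (_ - _); rewrite mulrC.
case=> a [b ->].
case sab: (straighten (corner_of a) (corner_of b)) => [[w z]|].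
  exact: straight sab.
case sba: (straighten (corner_of b) (corner_of a)) => [[w z]|].
  by rewrite mulrC joinC meetC; apply: straight sba.
have /orP[ab|ba] := clash_free_comparable sab sba.
  rewrite join_r // meet_l // mulrC subrr.
  exact: ideal_gen0.
rewrite join_l // meet_r // subrr.
exact: ideal_gen0.
Qed.

Lemma fibre_gen_join_meet p :
  fibre_gen var_corner corner_var p -> join_meet_ideal K L p.
Proof.
case=> i [j [w [z [sij ->]]]]; apply: ideal_gen_incl.
exists (enum_val i), (enum_val j).
have [-> ->] := straighten_join_meet sij.
by rewrite /lattice_var !enum_valK; congr (_ - _); rewrite mulrC.
Qed.

(** The hypotheses say that the elements a_(i1+1), b_1 and b_(k+1) of the grid
    exist and lie strictly between their neighbours. *)
Lemma join_meet_ideal_radical : radical_ideal (join_meet_ideal K L).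
Proof.
have JI p : join_meet_ideal K L p <-> fibre_ideal p.
  split.
    exact: (@ideal_gen_morph _ _ _ _ idfun join_meet_gen_fibre).
  exact: (@ideal_gen_morph _ _ _ _ idfun fibre_gen_join_meet).
move=> p; rewrite JI -(fibre_radical corner_varK var_corner_G11 p).
by split=> -[e /JI]; exists e.
Qed.

End InflatedGrid.

Theorem theorem1p3 (K : fieldType) (n1 n2 i1 i2 k' : nat)
  (hn1 : 5 <= n1) (hn2 : 5 <= n2) (hi1 : 1 < i1)
  (hi2 : 4 < i2 < n2) (hi2n1 : i2 <= n1) (hi21 : 2 <= i2 - i1)
  (hk : 3 <= k') (hkn2 : k' <= n2 - 2) (hkn1' : k' <> n1) (hkn2' : k' <> n2) :
  radical_ideal
    (join_meet_ideal K (L2 (L2_wf_intro hi1 hi21 hi2n1 hk hkn2))).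
Proof. by apply: join_meet_ideal_radical; lia. Qed.
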